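(* In the isotropic setting below, fix $r>0$, $F\in\mathrm{GL}^+(3)$, $C_p\in\mathrm{PSym}(3)$, and let $U_p=\sqrt{C_p}$, $\varphi:=\sqrt{\mathrm{tr}[(\mathrm{dev}_3\widetilde\Sigma)^2]}$ (well defined, since $\mathrm{tr}[(\mathrm{dev}_3\widetilde\Sigma)^2]\ge0$). Define the Helm admissible set $\mathcal H_r:=\{0\}$ if $\varphi<r$, $\mathcal H_r:=\{-\lambda\,C_p^{-1}\mathrm{dev}_3\widetilde\Sigma/\varphi:\lambda\ge0\}$ if $\varphi=r$, $\mathcal H_r:=\emptyset$ if $\varphi>r$. Then $$\mathcal H_r=-U_p^{-1}\,\mathcal N_r(\mathring\Sigma)\,U_p^{-1}.$$ Equivalently, with $Z=\frac{d}{dt}[C_p^{-1}]$ and $\frac{d}{dt}[C_p]=-C_pZC_p$, the Helm flow rule $\frac{d}{dt}[C_p]=\lambda\,\frac{\mathrm{dev}_3\widetilde\Sigma}{\varphi}\,C_p$ (with $\lambda\ge0$, $\varphi\le r$, $\lambda(\varphi-r)=0$) holds if and only if the Grandi–Stefanelli flow rule $\sqrt{C_p}\,\frac{d}{dt}[C_p^{-1}]\sqrt{C_p}\in-\mathcal N_r(\mathring\Sigma)$ holds; hence in the isotropic case it is also equivalent to the Lion flow rule.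
   Context: $W$ objective and isotropic, written $W(F_e)=\Psi(I_1(C_e),I_2(C_e),I_3(C_e))$ with $\Psi\in C^1$; $\widetilde W(X)=\Psi(\mathrm{tr}X,\mathrm{tr}(\mathrm{Cof}X),\det X)$. $C=F^TF$. $\langle X,Y\rangle=\mathrm{tr}(XY^T)$, $\|\cdot\|$ Frobenius norm, $D$ gradient, $\mathrm{dev}_3X=X-\frac13\mathrm{tr}(X)\mathbb{1}$, $\mathrm{sym}X=\frac12(X+X^T)$. $\widetilde\Sigma:=2\,C\,D\widetilde W(CC_p^{-1})\,C_p^{-1}$ (not symmetric in general). $\mathring\Sigma:=2\,U_p^{-1}\mathrm{sym}[C\,D\widetilde W(CC_p^{-1})]U_p^{-1}$. For symmetric $S$: $\mathcal N_r(S)=\{0\}$ if $\|\mathrm{dev}_3S\|<r$, $\{\lambda\,\mathrm{dev}_3S/\|\mathrm{dev}_3S\|:\lambda\ge0\}$ if $\|\mathrm{dev}_3S\|=r$, $\emptyset$ if $\|\mathrm{dev}_3S\|>r$. $M\mathcal AN=\{MXN:X\in\mathcal A\}$. The Lion flow rule is $\frac{d}{dt}[C_p^{-1}]\in-F_p^{-1}\mathcal N_r(\Sigma_e)F_p^{-T}$ with $\Sigma_e=F_e^TDW(F_e)$, $F_e=FF_p^{-1}$, $C_p=F_p^TF_p$. *)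

(* Defs.v *)
From Stdlib Require Import Reals.
Open Scope R_scope.

Inductive idx : Type := I0 | I1 | I2.

Definition Mat := idx -> idx -> R.
Definition Vec := idx -> R.

Definition sum3 (f : idx -> R) : R := f I0 + f I1 + f I2.

Definition mzero : Mat := fun _ _ => 0.
Definition mid : Mat := fun i j => match i, j with
  | I0, I0 | I1, I1 | I2, I2 => 1 | _, _ => 0 end.
Definition madd (A B : Mat) : Mat := fun i j => A i j + B i j.
Definition mscal (a : R) (A : Mat) : Mat := fun i j => a * A i j.
Definition mopp (A : Mat) : Mat := fun i j => - A i j.
Definition msub (A B : Mat) : Mat := fun i j => A i j - B i j.
Definition mmul (A B : Mat) : Mat := fun i j => sum3 (fun k => A i k * B k j).
Definition mtr (A : Mat) : Mat := fun i j => A j i.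
Definition tr (A : Mat) : R := sum3 (fun i => A i i).

(* cyclic successor on indices; gives the 3x3 cofactor with correct sign *)
Definition nx (i : idx) : idx := match i with I0 => I1 | I1 => I2 | I2 => I0 end.

(* cofactor matrix: Cof A i j = (-1)^(i+j) * minor_{ij} A *)
Definition cof (A : Mat) : Mat := fun i j =>
  A (nx i) (nx j) * A (nx (nx i)) (nx (nx j))
  - A (nx i) (nx (nx j)) * A (nx (nx i)) (nx j).

Definition det (A : Mat) : R := sum3 (fun j => A I0 j * cof A I0 j).

Definition minv (A : Mat) : Mat := mscal (/ det A) (mtr (cof A)).

Definition dev3 (X : Mat) : Mat := msub X (mscal (tr X / 3) mid).
Definition msym (X : Mat) : Mat := mscal (1/2) (madd X (mtr X)).
Definition fnorm (X : Mat) : R := sqrt (sum3 (fun i => sum3 (fun j => X i j ^ 2))).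

Definition symmetric (A : Mat) : Prop := mtr A = A.
Definition posdef (A : Mat) : Prop :=
  forall v : Vec, v <> (fun _ => 0) ->
    0 < sum3 (fun i => sum3 (fun j => v i * A i j * v j)).
Definition PSym (A : Mat) : Prop := symmetric A /\ posdef A.

Definition Emat (i j : idx) : Mat := fun k l =>
  if andb (match k, i with I0,I0|I1,I1|I2,I2 => true | _,_ => false end)
          (match l, j with I0,I0|I1,I1|I2,I2 => true | _,_ => false end)
  then 1 else 0.

(* G is the gradient (w.r.t. the Frobenius product <X,Y> = tr(X Y^T)) of f at X:
   its entries are the partial derivatives of f in the directions E_ij. *)
Definition is_gradient (f : Mat -> R) (X G : Mat) : Prop :=
  forall i j, derivable_pt_lim (fun t => f (madd X (mscal t (Emat i j)))) 0 (G i j).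

Definition cont3 (g : R -> R -> R -> R) (a b c : R) : Prop :=
  forall eps, 0 < eps -> exists delta, 0 < delta /\
    forall x y z, Rabs (x - a) < delta -> Rabs (y - b) < delta -> Rabs (z - c) < delta ->
      Rabs (g x y z - g a b c) < eps.

(* Psi is C^1 on the open octant (0,oo)^3 (the range of the invariants
   (I1,I2,I3) of positive definite matrices) *)
Definition C1_pos (Psi : R -> R -> R -> R) : Prop :=
  exists d1 d2 d3 : R -> R -> R -> R,
    forall a b c, 0 < a -> 0 < b -> 0 < c ->
      derivable_pt_lim (fun x => Psi x b c) a (d1 a b c) /\
      derivable_pt_lim (fun y => Psi a y c) b (d2 a b c) /\
      derivable_pt_lim (fun z => Psi a b z) c (d3 a b c) /\
      cont3 d1 a b c /\ cont3 d2 a b c /\ cont3 d3 a b c.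

Definition Wt (Psi : R -> R -> R -> R) (X : Mat) : R := Psi (tr X) (tr (cof X)) (det X).

Definition Cmat (F : Mat) : Mat := mmul (mtr F) F.

(* Sigma~ = 2 C DW~(C Cp^{-1}) Cp^{-1}, with G = DW~(C Cp^{-1}) *)
Definition Sig_tilde (F Cp G : Mat) : Mat :=
  mscal 2 (mmul (mmul (Cmat F) G) (minv Cp)).

Definition Sig_ring (F Up G : Mat) : Mat :=
  mscal 2 (mmul (mmul (minv Up) (msym (mmul (Cmat F) G))) (minv Up)).

Definition Ncone (r : R) (S Y : Mat) : Prop :=
  (fnorm (dev3 S) < r /\ Y = mzero) \/
  (fnorm (dev3 S) = r /\ exists lam, 0 <= lam /\ Y = mscal (lam / fnorm (dev3 S)) (dev3 S)).

Definition phi_of (Sigt : Mat) : R := sqrt (tr (mmul (dev3 Sigt) (dev3 Sigt))).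

Definition Helm (r : R) (Cp Sigt Y : Mat) : Prop :=
  (phi_of Sigt < r /\ Y = mzero) \/
  (phi_of Sigt = r /\ exists lam, 0 <= lam /\
     Y = mopp (mscal (lam / phi_of Sigt) (mmul (minv Cp) (dev3 Sigt)))).

(* Main.v *)
(** Isotropy is what makes the theorem work.  Since [Psi] is differentiable,
    [DW~(X) = Psi_1 1 + Psi_2 (tr X 1 - X^T) + Psi_3 Cof X], and for
    [X = C Cp^{-1}] with [C], [Cp] symmetric the product [C DW~(X)] is then
    symmetric.  Hence [Sig_ring = 2 Up^{-1} C DW~(X) Up^{-1}] and
    [Sig_tilde = Up Sig_ring Up^{-1}] are similar; [dev3] commutes with
    similarity and [tr((Up D Up^{-1})^2) = tr(D^2) = |D|^2] for symmetric [D],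
    so [phi] is the Frobenius norm of [dev3 Sig_ring], and both sides of each
    equivalence are the same cone transported by [Y |-> -Up^{-1} Y Up^{-1}]. *)
Require Import Defs.
From Stdlib Require Import Reals Lra Psatz FunctionalExtensionality Classical.
Open Scope R_scope.

Ltac mat_ext :=
  apply functional_extensionality; let i := fresh "i" in intro i;
  apply functional_extensionality; let j := fresh "j" in intro j;
  destruct i, j.

Ltac mat_unfold :=
  unfold msym, dev3, minv, mmul, madd, msub, mscal, mopp, mtr, mid, mzero,
    tr, det, cof, nx, sum3;
  simpl.

Lemma mmulA A B C : mmul (mmul A B) C = mmul A (mmul B C).
Proof. mat_ext; mat_unfold; ring. Qed.
Lemma mmul1m A : mmul mid A = A.
Proof. mat_ext; mat_unfold; ring. Qed.
Lemma mmulm1 A : mmul A mid = A.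
Proof. mat_ext; mat_unfold; ring. Qed.
Lemma mmul0m A : mmul mzero A = mzero.
Proof. mat_ext; mat_unfold; ring. Qed.
Lemma mmulm0 A : mmul A mzero = mzero.
Proof. mat_ext; mat_unfold; ring. Qed.
Lemma mmulZl a A B : mmul (mscal a A) B = mscal a (mmul A B).
Proof. mat_ext; mat_unfold; ring. Qed.
Lemma mmulZr a A B : mmul A (mscal a B) = mscal a (mmul A B).
Proof. mat_ext; mat_unfold; ring. Qed.
Lemma mmulNl A B : mmul (mopp A) B = mopp (mmul A B).
Proof. mat_ext; mat_unfold; ring. Qed.
Lemma mmulNr A B : mmul A (mopp B) = mopp (mmul A B).
Proof. mat_ext; mat_unfold; ring. Qed.
Lemma mmulBl A B C : mmul (msub A B) C = msub (mmul A C) (mmul B C).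
Proof. mat_ext; mat_unfold; ring. Qed.
Lemma mmulBr A B C : mmul C (msub A B) = msub (mmul C A) (mmul C B).
Proof. mat_ext; mat_unfold; ring. Qed.
Lemma mscal0 A : mscal 0 A = mzero.
Proof. mat_ext; mat_unfold; ring. Qed.
Lemma mopp0 : mopp mzero = mzero.
Proof. mat_ext; mat_unfold; ring. Qed.
Lemma moppK A : mopp (mopp A) = A.
Proof. mat_ext; mat_unfold; ring. Qed.
Lemma mtrK A : mtr (mtr A) = A.
Proof. mat_ext; mat_unfold; ring. Qed.
Lemma mtr_mmul A B : mtr (mmul A B) = mmul (mtr B) (mtr A).
Proof. mat_ext; mat_unfold; ring. Qed.
Lemma tr_mmulC A B : tr (mmul A B) = tr (mmul B A).
Proof. mat_unfold; ring. Qed.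
Lemma cof_mmul A B : cof (mmul A B) = mmul (cof A) (cof B).
Proof. mat_ext; mat_unfold; ring. Qed.
Lemma cof_mtr A : cof (mtr A) = mtr (cof A).
Proof. mat_ext; mat_unfold; ring. Qed.
Lemma det_mmul A B : det (mmul A B) = det A * det B.
Proof. mat_unfold; ring. Qed.
Lemma det_mtr A : det (mtr A) = det A.
Proof. mat_unfold; ring. Qed.
Lemma det_cof A : det (cof A) = det A ^ 2.
Proof. mat_unfold; ring. Qed.
Lemma det0 : det mzero = 0.
Proof. mat_unfold; ring. Qed.
Lemma mmul_adj A : mmul A (mtr (cof A)) = mscal (det A) mid.
Proof. mat_ext; mat_unfold; ring. Qed.
Lemma adj_mmul A : mmul (mtr (cof A)) A = mscal (det A) mid.
Proof. mat_ext; mat_unfold; ring. Qed.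

Lemma mulmV A : det A <> 0 -> mmul A (minv A) = mid.
Proof.
  intro dA. unfold minv. rewrite mmulZr, mmul_adj.
  mat_ext; mat_unfold; field; exact dA.
Qed.

Lemma mulVm A : det A <> 0 -> mmul (minv A) A = mid.
Proof.
  intro dA. unfold minv. rewrite mmulZl, adj_mmul.
  mat_ext; mat_unfold; field; exact dA.
Qed.

Lemma minv_mmul A B : minv (mmul A B) = mmul (minv B) (minv A).
Proof.
  unfold minv. rewrite cof_mmul, det_mmul, mtr_mmul, mmulZl, mmulZr.
  mat_ext; unfold mscal; rewrite Rinv_mult; ring.
Qed.

Lemma det_minv_neq0 A : det A <> 0 -> det (minv A) <> 0.
Proof.
  intros dA dV. assert (E : det (mmul (minv A) A) = 1)
    by (rewrite mulVm by exact dA; mat_unfold; ring).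
  rewrite det_mmul, dV in E. lra.
Qed.

Lemma conj_mmul_inj U V A B : mmul U V = mid -> mmul V U = mid ->
  mmul (mmul U A) U = mmul (mmul U B) U -> A = B.
Proof.
  intros UV VU E. apply (f_equal (fun X => mmul (mmul V X) V)) in E.
  rewrite !mmulA, UV, <- !mmulA, VU, !mmul1m, !mmulm1 in E. exact E.
Qed.

Lemma dev3_conj A B Y : mmul A B = mid -> mmul B A = mid ->
  dev3 (mmul (mmul A Y) B) = mmul (mmul A (dev3 Y)) B.
Proof.
  intros AB BA. assert (T : tr (mmul (mmul A Y) B) = tr Y)
    by (rewrite tr_mmulC, <- mmulA, BA, mmul1m; reflexivity).
  unfold dev3. rewrite T, mmulBr, mmulBl, mmulZr, mmulZl, mmulm1, AB. reflexivity.
Qed.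

Lemma symmetric_entry A : symmetric A -> forall i j, A i j = A j i.
Proof. intros H i j. change (A i j = mtr A i j). rewrite H. reflexivity. Qed.

Ltac sym_entries H :=
  let E := fresh "E" in pose proof (symmetric_entry _ H) as E;
  rewrite ?(E I1 I0), ?(E I2 I0), ?(E I2 I1).

Lemma symmetric_cof A : symmetric A -> symmetric (cof A).
Proof. unfold symmetric. intro H. rewrite <- cof_mtr, H. reflexivity. Qed.

Lemma symmetric_minv A : symmetric A -> symmetric (minv A).
Proof.
  intro H. pose proof (symmetric_entry _ (symmetric_cof A H)) as E.
  unfold symmetric, minv. mat_ext; unfold mtr, mscal; f_equal; apply E.
Qed.

Lemma symmetric_mmulTm A : symmetric (mmul (mtr A) A).
Proof. unfold symmetric. rewrite mtr_mmul, mtrK. reflexivity. Qed.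

Lemma symmetric_sq A : symmetric A -> symmetric (mmul A A).
Proof. unfold symmetric. intro H. rewrite mtr_mmul, H. reflexivity. Qed.

Lemma symmetric_conj V S : symmetric V -> symmetric S -> symmetric (mmul (mmul V S) V).
Proof. unfold symmetric. intros HV HS. rewrite !mtr_mmul, HV, HS, mmulA. reflexivity. Qed.

Lemma symmetric_scal a S : symmetric S -> symmetric (mscal a S).
Proof. unfold symmetric. intro H. rewrite <- H at 2. mat_ext; mat_unfold; ring. Qed.

Lemma symmetric_dev3 S : symmetric S -> symmetric (dev3 S).
Proof. intro H. unfold symmetric. mat_ext; mat_unfold; sym_entries H; ring. Qed.

Lemma msym_id S : symmetric S -> msym S = S.
Proof. intro H. mat_ext; mat_unfold; sym_entries H; field. Qed.

Definition fnorm_sq (Y : Mat) : R := sum3 (fun i => sum3 (fun j => Y i j ^ 2)).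

Lemma entry_sq_le_fnorm_sq Y i j : Y i j ^ 2 <= fnorm_sq Y.
Proof.
  unfold fnorm_sq, sum3.
  pose proof (pow2_ge_0 (Y I0 I0)); pose proof (pow2_ge_0 (Y I0 I1));
  pose proof (pow2_ge_0 (Y I0 I2)); pose proof (pow2_ge_0 (Y I1 I0));
  pose proof (pow2_ge_0 (Y I1 I1)); pose proof (pow2_ge_0 (Y I1 I2));
  pose proof (pow2_ge_0 (Y I2 I0)); pose proof (pow2_ge_0 (Y I2 I1));
  pose proof (pow2_ge_0 (Y I2 I2)). destruct i, j; lra.
Qed.

Lemma fnorm_sq_ge0 Y : 0 <= fnorm_sq Y.
Proof. apply Rle_trans with (Y I0 I0 ^ 2); [apply pow2_ge_0|apply entry_sq_le_fnorm_sq]. Qed.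

Lemma fnorm_sq_gt0 Y : det Y <> 0 -> 0 < fnorm_sq Y.
Proof.
  intro dY. destruct (Rle_lt_dec (fnorm_sq Y) 0) as [H|H]; [|exact H].
  exfalso. apply dY.
  replace Y with mzero by (mat_ext; symmetry;
    match goal with |- Y ?i ?j = _ => pose proof (entry_sq_le_fnorm_sq Y i j) end;
    unfold mzero; nra).
  exact det0.
Qed.

Lemma tr_sq_symmetric D : symmetric D -> tr (mmul D D) = fnorm_sq D.
Proof. intro H. unfold fnorm_sq. mat_unfold. sym_entries H. ring. Qed.

Lemma tr_mmulTm_sq A W : symmetric W ->
  tr (mmul (mmul (mtr A) A) (mmul W W)) = fnorm_sq (mmul A W).
Proof. intro H. unfold fnorm_sq. mat_unfold. sym_entries H. ring. Qed.

Definition quad (A : Mat) (v : Vec) : R := sum3 (fun i => sum3 (fun j => v i * A i j * v j)).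

Lemma posdef_quad_le0 A v : posdef A -> quad A v <= 0 -> forall i, v i = 0.
Proof.
  intros HA hv i. destruct (classic (v = (fun _ => 0))) as [->|nv]; [reflexivity|].
  pose proof (HA v nv). unfold quad in hv. lra.
Qed.

Lemma quad_cof_row A k : quad A (fun i => cof A k i) = cof A k k * det A.
Proof. destruct k; unfold quad; mat_unfold; ring. Qed.

Lemma PSym_cof0 A : PSym A -> det A = 0 -> forall k i, cof A k i = 0.
Proof.
  intros [_ HA] dA k. apply (posdef_quad_le0 A _ HA).
  rewrite quad_cof_row, dA. lra.
Qed.

Lemma PSym_det_neq0 A : PSym A -> det A <> 0.
Proof.
  intros HA dA. pose proof (PSym_cof0 A HA dA) as Hc. destruct HA as [HS HP].
  set (e1 := fun i => match i with I1 => 1 | _ => 0 end).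
  assert (h11 : 0 < A I1 I1).
  { assert (ne : e1 <> (fun _ => 0))
      by (intro E; apply (f_equal (fun f => f I1)) in E; unfold e1 in E; lra).
    pose proof (HP e1 ne) as H. unfold e1, sum3 in H. simpl in H. lra. }
  (* [quad A w = A 1 1 * cof A 2 2 = 0] forces [w = 0], contradicting [w 0 = A 1 1 > 0]. *)
  set (w := fun i => match i with I0 => A I1 I1 | I1 => - A I1 I0 | I2 => 0 end).
  assert (hw : quad A w <= 0).
  { replace (quad A w) with (A I1 I1 * cof A I2 I2)
      by (unfold quad, w; mat_unfold; sym_entries HS; ring).
    rewrite Hc. lra. }
  pose proof (posdef_quad_le0 A w HP hw I0) as H0. unfold w in H0. lra.
Qed.

(** * A chain rule in three variables *)

Lemma mvt_between f f' u v :
  (forall x, Rmin u v <= x <= Rmax u v -> derivable_pt_lim f x (f' x)) ->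
  exists x, Rabs (x - u) <= Rabs (v - u) /\ Rmin u v <= x /\ f v - f u = f' x * (v - u).
Proof.
  intro H. destruct (Rtotal_order u v) as [Hlt|[<-|Hgt]].
  - destruct (MVT_cor2 f f' u v Hlt) as [x [E Hx]].
    { intros x Hx; apply H. rewrite Rmin_left, Rmax_right by lra. lra. }
    exists x. rewrite Rmin_left by lra. rewrite !Rabs_right by lra. lra.
  - exists u. rewrite Rmin_left by lra. split; [lra|]. split; [lra|ring].
  - destruct (MVT_cor2 f f' v u Hgt) as [x [E Hx]].
    { intros x Hx; apply H. rewrite Rmin_right, Rmax_left by lra. lra. }
    exists x. rewrite Rmin_right by lra. rewrite !Rabs_left1 by lra. lra.
Qed.

Lemma small_affine_steps al be ga m : 0 < m -> exists delta, 0 < delta /\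
  forall h, Rabs h < delta -> Rabs (h * al) < m /\ Rabs (h * be) < m /\ Rabs (h * ga) < m.
Proof.
  intro hm. set (K := Rabs al + Rabs be + Rabs ga + 1).
  pose proof (Rabs_pos al); pose proof (Rabs_pos be); pose proof (Rabs_pos ga).
  assert (hK : 0 < K) by (unfold K; lra).
  exists (m / K). split; [apply Rdiv_lt_0_compat; lra|].
  intros h hh. assert (hhK : Rabs h * K < m).
  { apply (Rmult_lt_compat_r K) in hh; [|exact hK].
    unfold Rdiv in hh. rewrite Rmult_assoc, Rinv_l in hh; lra. }
  pose proof (Rabs_pos h). rewrite !Rabs_mult. unfold K in hhK. nra.
Qed.

Lemma Rabs_bounds x : - Rabs x <= x <= Rabs x.
Proof. split_Rabs; lra. Qed.

(* The increment in the first variable, computed by the mean value theorem;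
   continuity of the partial derivative makes its difference quotient converge. *)
Lemma derivable_pt_lim_first_increment (Phi D : R -> R -> R -> R) a b c al be ga :
  (forall x y z, 0 < x -> 0 < y -> 0 < z -> derivable_pt_lim (fun x => Phi x y z) x (D x y z)) ->
  cont3 D a b c -> 0 < a -> 0 < b -> 0 < c ->
  derivable_pt_lim
    (fun h => Phi (a + h * al) (b + h * be) (c + h * ga) - Phi a (b + h * be) (c + h * ga))
    0 (D a b c * al).
Proof.
  intros HD HC ha hb hc eps heps.
  pose proof (Rabs_pos al).
  destruct (HC (eps / (Rabs al + 1))) as [d [hd Hd]]; [apply Rdiv_lt_0_compat; lra|].
  set (m := Rmin d (Rmin a (Rmin b c))).
  assert (hm : 0 < m) by (unfold m; repeat apply Rmin_glb_lt; assumption).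
  assert (md : m <= d /\ m <= a /\ m <= b /\ m <= c).
  { unfold m. pose proof (Rmin_l d (Rmin a (Rmin b c))); pose proof (Rmin_r d (Rmin a (Rmin b c)));
    pose proof (Rmin_l a (Rmin b c)); pose proof (Rmin_r a (Rmin b c));
    pose proof (Rmin_l b c); pose proof (Rmin_r b c). lra. }
  destruct (small_affine_steps al be ga m hm) as [delta [hdel Hdel]].
  exists (mkposreal delta hdel). intros h hn hh. simpl in hh.
  destruct (Hdel h hh) as [Ha [Hb Hc]].
  pose proof (Rabs_bounds (h * al)); pose proof (Rabs_bounds (h * be));
  pose proof (Rabs_bounds (h * ga)).
  rewrite Rplus_0_l, !Rmult_0_l, !Rplus_0_r, Rminus_diag, Rminus_0_r.
  set (y := b + h * be). set (z := c + h * ga).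
  assert (hy : 0 < y) by (unfold y; lra). assert (hz : 0 < z) by (unfold z; lra).
  destruct (mvt_between (fun x => Phi x y z) (fun x => D x y z) a (a + h * al))
    as [xi [Hxi [Hmin E]]].
  { intros x [Hx _]. apply HD; [|exact hy|exact hz].
    eapply Rlt_le_trans; [|exact Hx]. apply Rmin_glb_lt; lra. }
  rewrite E.
  replace (D xi y z * (a + h * al - a) / h - D a b c * al)
    with ((D xi y z - D a b c) * al) by (field; exact hn).
  assert (HDx : Rabs (D xi y z - D a b c) < eps / (Rabs al + 1)).
  { replace (a + h * al - a) with (h * al) in Hxi by ring.
    apply Hd; unfold y, z; [lra| |].
    - replace (b + h * be - b) with (h * be) by ring. lra.
    - replace (c + h * ga - c) with (h * ga) by ring. lra. }
  rewrite Rabs_mult.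
  apply Rle_lt_trans with (eps / (Rabs al + 1) * Rabs al).
  - apply Rmult_le_compat_r; [exact (Rabs_pos al)|lra].
  - apply (Rmult_lt_reg_r (Rabs al + 1)); [lra|].
    replace (eps / (Rabs al + 1) * Rabs al * (Rabs al + 1)) with (eps * Rabs al) by (field; lra).
    nra.
Qed.

Lemma cont3_swap12 (g : R -> R -> R -> R) a b c :
  cont3 g a b c -> cont3 (fun y x z => g x y z) b a c.
Proof.
  intros H eps heps. destruct (H eps heps) as [d [hd Hd]].
  exists d. split; [exact hd|]. intros y x z hy hx hz. exact (Hd x y z hx hy hz).
Qed.

Lemma derivable_pt_lim_affine c g : derivable_pt_lim (fun t => c + t * g) 0 g.
Proof.
  intros eps he. exists (mkposreal eps he). intros h hn _. simpl.
  replace ((c + (0 + h) * g - (c + 0 * g)) / h - g) with 0 by (field; exact hn).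
  rewrite Rabs_R0. exact he.
Qed.

(* Split the increment into one step per variable; the last one is a genuine
   one-variable derivative, the first two are handled by the mean value theorem. *)
Lemma chain_rule3 (Psi d1 d2 d3 : R -> R -> R -> R) a b c al be ga :
  (forall x y z, 0 < x -> 0 < y -> 0 < z ->
     derivable_pt_lim (fun x => Psi x y z) x (d1 x y z) /\
     derivable_pt_lim (fun y => Psi x y z) y (d2 x y z) /\
     derivable_pt_lim (fun z => Psi x y z) z (d3 x y z)) ->
  cont3 d1 a b c -> cont3 d2 a b c -> 0 < a -> 0 < b -> 0 < c ->
  derivable_pt_lim (fun t => Psi (a + t * al) (b + t * be) (c + t * ga)) 0
    (d1 a b c * al + d2 a b c * be + d3 a b c * ga).
Proof.
  intros HD H1 H2 ha hb hc.
  pose proof (derivable_pt_lim_first_increment Psi d1 a b c al be ga) as T1.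
  pose proof (derivable_pt_lim_first_increment (fun y x z => Psi x y z)
                (fun y x z => d2 x y z) b a c be 0 ga) as T2.
  assert (T3 : derivable_pt_lim (fun h => Psi a b (c + h * ga)) 0 (d3 a b c * ga)).
  { apply (derivable_pt_lim_comp (fun t => c + t * ga) (fun z => Psi a b z)).
    - apply derivable_pt_lim_affine.
    - rewrite Rmult_0_l, Rplus_0_r. apply HD; assumption. }
  replace (fun t => Psi (a + t * al) (b + t * be) (c + t * ga))
    with (plus_fct (plus_fct
      (fun h => Psi (a + h * al) (b + h * be) (c + h * ga) - Psi a (b + h * be) (c + h * ga))
      (fun h => Psi (a + h * 0) (b + h * be) (c + h * ga) - Psi (a + h * 0) b (c + h * ga)))
      (fun h => Psi a b (c + h * ga)))
    by (extensionality t; unfold plus_fct; rewrite Rmult_0_r, Rplus_0_r; ring).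
  apply derivable_pt_lim_plus; [apply derivable_pt_lim_plus|exact T3].
  - apply T1; try assumption. intros x y z hx hy hz. apply HD; assumption.
  - apply T2; try assumption.
    + intros y x z hy hx hz. apply HD; assumption.
    + apply cont3_swap12. exact H2.
Qed.

(** * The gradient of an isotropic energy *)

Definition iso_grad (e1 e2 e3 : R) (X : Mat) : Mat := fun i j =>
  e1 * mid i j + e2 * (tr X * mid i j - X j i) + e3 * cof X i j.

Lemma Wt_line Psi X i j t : Wt Psi (madd X (mscal t (Emat i j))) =
  Psi (tr X + t * mid i j) (tr (cof X) + t * (tr X * mid i j - X j i))
      (det X + t * cof X i j).
Proof. destruct i, j; unfold Wt; f_equal; unfold Emat; mat_unfold; ring. Qed.

Lemma gradient_Wt Psi X G : C1_pos Psi ->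
  0 < tr X -> 0 < tr (cof X) -> 0 < det X ->
  is_gradient (Wt Psi) X G -> exists e1 e2 e3, G = iso_grad e1 e2 e3 X.
Proof.
  intros [d1 [d2 [d3 HPsi]]] ha hb hc HG.
  destruct (HPsi _ _ _ ha hb hc) as [_ [_ [_ [C1 [C2 _]]]]].
  exists (d1 (tr X) (tr (cof X)) (det X)), (d2 (tr X) (tr (cof X)) (det X)),
         (d3 (tr X) (tr (cof X)) (det X)).
  extensionality i; extensionality j.
  apply (uniqueness_limite _ 0 _ _ (HG i j)).
  replace (fun t => Wt Psi (madd X (mscal t (Emat i j))))
    with (fun t => Psi (tr X + t * mid i j) (tr (cof X) + t * (tr X * mid i j - X j i))
                       (det X + t * cof X i j))
    by (extensionality t; symmetry; apply Wt_line).
  apply chain_rule3; try assumption.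
  intros x y z hx hy hz. destruct (HPsi x y z hx hy hz) as [? [? [? _]]]. auto.
Qed.

(* [C X^T = C M C] and [C Cof(C M) = det C Cof M] are symmetric. *)
Lemma symmetric_mmul_iso_grad C M e1 e2 e3 : symmetric C -> symmetric M ->
  symmetric (mmul C (iso_grad e1 e2 e3 (mmul C M))).
Proof.
  intros HC HM. pose proof (symmetric_entry _ HC) as EC.
  pose proof (symmetric_entry _ HM) as EM.
  unfold symmetric. mat_ext; unfold iso_grad; mat_unfold;
  rewrite (EC I1 I0), (EC I2 I0), (EC I2 I1), (EM I1 I0), (EM I2 I0), (EM I2 I1); ring.
Qed.

Lemma invariants_pos A W : det A <> 0 -> symmetric W -> det W <> 0 ->
  let X := mmul (mmul (mtr A) A) (mmul W W) in
  0 < tr X /\ 0 < tr (cof X) /\ 0 < det X.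
Proof.
  intros dA HW dW X. unfold X. split; [|split].
  - rewrite tr_mmulTm_sq by exact HW. apply fnorm_sq_gt0.
    rewrite det_mmul. apply Rmult_integral_contrapositive. tauto.
  - rewrite !cof_mmul, cof_mtr, tr_mmulTm_sq by (apply symmetric_cof; exact HW).
    apply fnorm_sq_gt0. rewrite det_mmul, !det_cof.
    apply Rmult_integral_contrapositive; split; apply pow_nonzero; assumption.
  - rewrite !det_mmul, det_mtr.
    assert (0 < det A * det A) by (destruct (Rlt_dec 0 (det A)); nra).
    assert (0 < det W * det W) by (destruct (Rlt_dec 0 (det W)); nra).
    nra.
Qed.

(** * Transport by similarity *)

Section Similarity.

Variables (r : R) (U S : Mat).
Hypothesis detU : det U <> 0.
Hypothesis symS : symmetric S.

Let V := minv U.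
Let UV : mmul U V = mid. Proof. exact (mulmV U detU). Qed.
Let VU : mmul V U = mid. Proof. exact (mulVm U detU). Qed.

Lemma dev3_similar : dev3 (mmul (mmul U S) V) = mmul (mmul U (dev3 S)) V.
Proof. exact (dev3_conj U V S UV VU). Qed.

Lemma tr_dev3_sq_similar :
  tr (mmul (dev3 (mmul (mmul U S) V)) (dev3 (mmul (mmul U S) V))) = fnorm_sq (dev3 S).
Proof.
  rewrite dev3_similar, !mmulA, <- (mmulA V U), VU, mmul1m, tr_mmulC, !mmulA, VU, mmulm1.
  apply tr_sq_symmetric, symmetric_dev3, symS.
Qed.

Lemma phi_of_similar : phi_of (mmul (mmul U S) V) = fnorm (dev3 S).
Proof. unfold phi_of. rewrite tr_dev3_sq_similar. reflexivity. Qed.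

Lemma Helm_similar Y : Helm r (mmul U U) (mmul (mmul U S) V) Y <->
  exists Y', Ncone r S Y' /\ Y = mopp (mmul (mmul V Y') V).
Proof.
  assert (K : mmul (minv (mmul U U)) (dev3 (mmul (mmul U S) V))
              = mmul (mmul V (dev3 S)) V).
  { rewrite minv_mmul, dev3_similar. fold V.
    rewrite !mmulA, <- (mmulA V U), VU, mmul1m. reflexivity. }
  unfold Helm, Ncone. rewrite phi_of_similar, K. split.
  - intros [[hlt ->]|[heq [lam [hl ->]]]].
    + exists mzero. split; [left; split; [exact hlt|reflexivity]|].
      rewrite mmulm0, mmul0m, mopp0. reflexivity.
    + exists (mscal (lam / fnorm (dev3 S)) (dev3 S)). split.
      * right. split; [exact heq|]. exists lam. split; [exact hl|reflexivity].
      * rewrite mmulZr, mmulZl. reflexivity.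
  - intros [Y' [[[hlt ->]|[heq [lam [hl ->]]]] ->]].
    + left. split; [exact hlt|]. rewrite mmulm0, mmul0m, mopp0. reflexivity.
    + right. split; [exact heq|]. exists lam. split; [exact hl|].
      rewrite mmulZr, mmulZl. reflexivity.
Qed.

Lemma flow_rule_similar Z :
  (exists lam, 0 <= lam /\ phi_of (mmul (mmul U S) V) <= r /\
     lam * (phi_of (mmul (mmul U S) V) - r) = 0 /\
     mopp (mmul (mmul (mmul U U) Z) (mmul U U)) =
       mmul (mscal (lam / phi_of (mmul (mmul U S) V)) (dev3 (mmul (mmul U S) V))) (mmul U U))
  <-> exists Y', Ncone r S Y' /\ mmul (mmul U Z) U = mopp Y'.
Proof.
  rewrite phi_of_similar. set (W := mmul (mmul U Z) U).
  assert (K : forall c, mmul (mscal c (dev3 (mmul (mmul U S) V))) (mmul U U)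
                        = mmul (mmul U (mscal c (dev3 S))) U).
  { intro c. rewrite mmulZl, dev3_similar, mmulZr, mmulZl, !mmulA,
      <- (mmulA V U), VU, mmul1m. reflexivity. }
  assert (EW : mopp (mmul (mmul (mmul U U) Z) (mmul U U)) = mmul (mmul U (mopp W)) U).
  { unfold W. rewrite mmulNr, mmulNl, !mmulA. reflexivity. }
  unfold Ncone. split.
  - intros [lam [hl [hle [h0 E]]]]. rewrite K, EW in E.
    apply (conj_mmul_inj U V _ _ UV VU) in E.
    exists (mopp W). split; [|rewrite moppK; reflexivity]. rewrite E.
    destruct hle as [hlt|heq].
    + left. split; [exact hlt|]. assert (lam = 0) by nra. subst lam.
      unfold Rdiv. rewrite Rmult_0_l. apply mscal0.
    + right. split; [exact heq|]. exists lam. split; [exact hl|reflexivity].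
  - intros [Y' [[[hlt ->]|[heq [lam [hl ->]]]] HW]].
    + exists 0. split; [lra|]. split; [lra|]. split; [ring|].
      rewrite K, EW, HW, moppK, mmulm0, mmul0m.
      unfold Rdiv. rewrite Rmult_0_l, mscal0, mmulm0, mmul0m. reflexivity.
    + exists lam. split; [exact hl|]. split; [lra|]. split; [rewrite heq; ring|].
      rewrite K, EW, HW, moppK. reflexivity.
Qed.

End Similarity.

Lemma symmetric_Sig_ring F Up G : symmetric Up -> symmetric (mmul (Cmat F) G) ->
  symmetric (Sig_ring F Up G).
Proof.
  intros HU HS. unfold Sig_ring. rewrite msym_id by exact HS.
  apply symmetric_scal, symmetric_conj; [apply symmetric_minv, HU|exact HS].
Qed.

Lemma Sig_tilde_similar F Up G : det Up <> 0 -> symmetric (mmul (Cmat F) G) ->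
  Sig_tilde F (mmul Up Up) G = mmul (mmul Up (Sig_ring F Up G)) (minv Up).
Proof.
  intros dU HS. unfold Sig_tilde, Sig_ring. rewrite msym_id by exact HS.
  rewrite minv_mmul, mmulZr, mmulZl, !mmulA, <- (mmulA Up (minv Up)), mulmV, mmul1m
    by exact dU.
  reflexivity.
Qed.

Theorem mainTheorem10 (Psi : R -> R -> R -> R) (r : R) (F Cp Up G : Mat) :
  C1_pos Psi ->
  0 < r ->
  0 < det F ->
  PSym Cp ->
  (* Up = sqrt(Cp): the unique symmetric positive definite square root *)
  PSym Up -> mmul Up Up = Cp ->
  (* G = D W~ (C Cp^{-1}) *)
  is_gradient (Wt Psi) (mmul (Cmat F) (minv Cp)) G ->
  0 <= tr (mmul (dev3 (Sig_tilde F Cp G)) (dev3 (Sig_tilde F Cp G))) /\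
  (forall Y : Mat,
     Helm r Cp (Sig_tilde F Cp G) Y <->
     exists Y', Ncone r (Sig_ring F Up G) Y' /\
                Y = mopp (mmul (mmul (minv Up) Y') (minv Up))) /\
  (forall Z : Mat,
     (exists lam, 0 <= lam /\ phi_of (Sig_tilde F Cp G) <= r /\
        lam * (phi_of (Sig_tilde F Cp G) - r) = 0 /\
        mopp (mmul (mmul Cp Z) Cp) =
          mmul (mscal (lam / phi_of (Sig_tilde F Cp G)) (dev3 (Sig_tilde F Cp G))) Cp)
     <->
     exists Y', Ncone r (Sig_ring F Up G) Y' /\ mmul (mmul Up Z) Up = mopp Y').
Proof.
  intros HPsi _ hF _ HUp <- HG.
  pose proof (PSym_det_neq0 Up HUp) as dU. destruct HUp as [symU _].
  rewrite minv_mmul in HG. set (X := mmul (Cmat F) (mmul (minv Up) (minv Up))) in HG.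
  destruct (invariants_pos F (minv Up) ltac:(lra) (symmetric_minv Up symU)
              (det_minv_neq0 Up dU)) as [h1 [h2 h3]].
  destruct (gradient_Wt Psi X G HPsi h1 h2 h3 HG) as [e1 [e2 [e3 ->]]].
  assert (HS : symmetric (mmul (Cmat F) (iso_grad e1 e2 e3 X))).
  { apply symmetric_mmul_iso_grad; [apply symmetric_mmulTm|].
    apply symmetric_sq, symmetric_minv, symU. }
  pose proof (symmetric_Sig_ring F Up _ symU HS) as symR.
  rewrite (Sig_tilde_similar F Up _ dU HS).
  split; [|split].
  - rewrite tr_dev3_sq_similar by assumption. apply fnorm_sq_ge0.
  - intro Y. exact (Helm_similar r _ _ dU symR Y).
  - intro Z. exact (flow_rule_similar r _ _ dU symR Z).
Qed.
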